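(* Let $\Sigma$ be a complete fan in $\mathbb{R}^n$, $\phi$ a strictly concave rational PL function on $\Sigma$, and $r\in\mathbb{N}^+$ such that $r\phi$ is integral. The following properties hold: (1) $\omega_{r\phi}(X_{u_\rho},-)=-d\langle\mu_{r\phi},u_\rho\rangle$ for all $\rho\in\Sigma(1)$; (2) $\theta_{r\phi}$ is invariant under the action of the real torus $(S^1)^n\subset(\mathbb{C}^\times)^n$ on $(\mathbb{C}^\times)^n$ by multiplication.
   Context: Let $n\ge 1$. A complete fan $\Sigma$ in $\mathbb{R}^n$ is a finite collection of strongly convex rational polyhedral cones, closed under taking faces and intersections (two cones meet along a common face), whose union is $\mathbb{R}^n$. $\Sigma(k)$ is the set of $k$-dimensional cones; for a ray $\rho\in\Sigma(1)$, $u_\rho\in\mathbb{Z}^n$ is its primitive generator. A PL function on $\Sigma$ is a continuous $\phi:\mathbb{R}^n\to\mathbb{R}$ linear on each cone; for $\sigma\in\Sigma(n)$ write $\phi|_\sigma=\langle m_\sigma,\cdot\rangle$. It is rational (resp. integral) if all $m_\sigma\in\mathbb{Q}^n$ (resp. $\mathbb{Z}^n$). It is strictly concave if $\phi(x)=\min_{\sigma\in\Sigma(n)}\langle m_\sigma,x\rangle$ for all $x$ and, for every $\sigma\in\Sigma(n)$, $\phi(x)=\langle m_\sigma,x\rangle$ if and only if $x\in\sigma$. Set $P_{r\phi}=\{m\in\mathbb{R}^n:\langle m,u_\rho\rangle\ge r\phi(u_\rho)\ \forall\rho\in\Sigma(1)\}$. For $m\in\mathbb{Z}^n$ let $\chi^m(z)=z_1^{m^{(1)}}\cdots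 z_n^{m^{(n)}}$ on $(\mathbb{C}^\times)^n$. Let $F_{r\phi}=\log\left(\sum_{m\in P_{r\phi}\cap\mathbb{Z}^n}|\chi^m|^2\right)$, $\theta_{r\phi}=\frac12 d^cF_{r\phi}$ with $d^c=-i(\partial-\bar\partial)$, i.e. $$\theta_{r\phi}=-\frac{i}{2}\sum_{k=1}^n\frac{\sum_{m\in P_{r\phi}\cap\mathbb{Z}^n}m^{(k)}|\chi^m|^2}{\sum_{m\in P_{r\phi}\cap\mathbb{Z}^n}|\chi^m|^2}\left(\frac{dz_k}{z_k}-\frac{d\overline{z}_k}{\overline{z}_k}\right),$$ and $\omega_{r\phi}=d\theta_{r\phi}=i\partial\bar\partial F_{r\phi}$. Let $$\mu_{r\phi}=\frac{\sum_{m\in P_{r\phi}\cap\mathbb{Z}^n}|\chi^m|^2\,m}{\sum_{m\in P_{r\phi}\cap\mathbb{Z}^n}|\chi^m|^2}:(\mathbb{C}^\times)^n\to\mathbb{R}^n.$$ Let $\lambda_{u_\rho}(t)=(t^{u_\rho^{(1)}},\dots,t^{u_\rho^{(n)}})$ for $t\in\mathbb{C}^\times$, and let $X_{u_\rho}$ be the vector field $X_{u_\rho}(z)=\frac{d}{d\alpha}\big|_{\alpha=0}\lambda_{u_\rho}(e^{i\alpha})\cdot z$ on $(\mathbb{C}^\times)^n$. *)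

(* Defs.v *)
From HB Require Import structures.
From mathcomp Require Import all_boot all_order all_algebra.
From mathcomp Require Import all_classical all_reals all_analysis.
From mathcomp Require Import complex.
Set Implicit Arguments.
Unset Strict Implicit.
Unset Printing Implicit Defensive.
Import Order.TTheory GRing.Theory Num.Theory.
Import numFieldNormedType.Exports.
Local Open Scope classical_set_scope.
Local Open Scope ring_scope.
Local Open Scope complex_scope.

Section Fans.
Variables (R : realType) (n : nat).
Implicit Types (sigma tau rho : set 'rV[R]_n) (Sigma : set (set 'rV[R]_n)).

Definition dotr (x y : 'rV[R]_n) : R := \sum_(k < n) x 0 k * y 0 k.

Definition intv (m : 'rV[int]_n) : 'rV[R]_n := map_mx intr m.

Definition rational_polyhedral_cone sigma :=
  exists (N : nat) (A : 'M[int]_(N, n)),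
    sigma = [set x | exists2 c : 'rV[R]_N,
                       forall i, 0 <= c 0 i & x = c *m map_mx intr A].

Definition strongly_convex sigma :=
  forall x, sigma x -> sigma (- x) -> x = 0.

(* Faces are cut out by supporting hyperplanes; m = 0 gives sigma itself. *)
Definition face tau sigma :=
  exists m : 'rV[R]_n, (forall x, sigma x -> 0 <= dotr m x) /\
    tau = [set x | sigma x /\ dotr m x = 0].

Definition cone_dim sigma (k : nat) :=
  exists U : {vspace 'rV[R]_n},
    [/\ forall x, sigma x -> x \in U,
        forall W : {vspace 'rV[R]_n},
          (forall x, sigma x -> x \in W) -> (U <= W)%VS
      & \dim U = k].

Definition fan Sigma :=
  [/\ finite_set Sigma,
      forall sigma, Sigma sigma ->
        rational_polyhedral_cone sigma /\ strongly_convex sigma,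
      forall sigma tau, Sigma sigma -> face tau sigma -> Sigma tau
    & forall sigma tau, Sigma sigma -> Sigma tau ->
        face (sigma `&` tau) sigma /\ face (sigma `&` tau) tau].

Definition complete_fan Sigma :=
  fan Sigma /\ \bigcup_(sigma in Sigma) sigma = setT.

Definition cones_of_dim Sigma (k : nat) : set (set 'rV[R]_n) :=
  [set sigma | Sigma sigma /\ cone_dim sigma k].

Definition rays Sigma := cones_of_dim Sigma 1.
Definition max_cones Sigma := cones_of_dim Sigma n.

(* An integer vector is primitive when its coordinates have gcd 1. *)
Definition is_primitive_generator rho (u : 'rV[int]_n) :=
  \big[gcdz/0]_(k < n) u 0 k = 1 /\
  rho = [set x | exists2 t : R, 0 <= t & x = t *: intv u].

(* Every ray of a rational fan has exactly one primitive generator; the default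
   value 0 only concerns sets that are not rational rays. *)
Definition prim_gen rho : 'rV[int]_n :=
  xget 0 [set u | is_primitive_generator rho u].

Definition PL_function Sigma (phi : 'rV[R]_n -> R) :=
  continuous phi /\
  forall sigma, Sigma sigma ->
    exists m : 'rV[R]_n, forall x, sigma x -> phi x = dotr m x.

(* The vector m_sigma: for a PL function and a cone of full dimension, it exists
   and is unique. *)
Definition slope (phi : 'rV[R]_n -> R) sigma : 'rV[R]_n :=
  xget 0 [set m | forall x, sigma x -> phi x = dotr m x].

Definition rational_PL Sigma (phi : 'rV[R]_n -> R) :=
  PL_function Sigma phi /\
  forall sigma, max_cones Sigma sigma ->
    exists q : 'rV[rat]_n, slope phi sigma = map_mx ratr q.

Definition integral_PL Sigma (phi : 'rV[R]_n -> R) :=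
  PL_function Sigma phi /\
  forall sigma, max_cones Sigma sigma ->
    exists m : 'rV[int]_n, slope phi sigma = intv m.

Definition strictly_concave Sigma (phi : 'rV[R]_n -> R) :=
  [/\ forall x sigma, max_cones Sigma sigma -> phi x <= dotr (slope phi sigma) x,
      forall x, exists2 sigma, max_cones Sigma sigma &
                               phi x = dotr (slope phi sigma) x
    & forall sigma, max_cones Sigma sigma ->
        forall x, phi x = dotr (slope phi sigma) x <-> sigma x].

Definition polytope Sigma (psi : 'rV[R]_n -> R) : set 'rV[R]_n :=
  [set m | forall rho, rays Sigma rho ->
             dotr m (intv (prim_gen rho)) >= psi (intv (prim_gen rho))].

Definition lattice_points (P : set 'rV[R]_n) : set 'rV[int]_n :=
  [set m | P (intv m)].

End Fans.

(* Calculus on open subsets of C^n = R^2n. Functions and forms are total on C^n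
   and are only meaningful on the open set where they are smooth. A complex
   valued 1-form (resp. 2-form) sends a point and one (resp. two) tangent
   vectors to a complex number. *)
Section ComplexCalculus.
Variables (R : realType) (n : nat).
Local Notation C := R[i].
Local Notation V := 'rV[R[i]]_n.

(* derivative of a complex-valued function of a real variable *)
Definition cderive1 (g : R -> C) (a : R) : C :=
  derive1 (fun t => complex.Re (g t)) a +i* derive1 (fun t => complex.Im (g t)) a.

(* velocity of a curve in C^n *)
Definition velocity (c : R -> V) (a : R) : V :=
  \row_(k < n) cderive1 (fun t => c t 0 k) a.

(* The line along which we differentiate has a real parameter. *)
Definition real_line (z v : V) (t : R) : V := z + t%:C *: v.

(* exterior derivative of a function: df_z(v) *)
Definition d0 (f : V -> C) (z v : V) : C :=
  cderive1 (fun t => f (real_line z v t)) 0.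

(* exterior derivative of a 1-form, with the convention
   dx /\ dy (v, w) = dx(v) dy(w) - dx(w) dy(v); v and w are extended to constant
   vector fields, so that the Lie bracket term vanishes. *)
Definition d1 (eta : V -> V -> C) (z v w : V) : C :=
  d0 (fun x => eta x w) z v - d0 (fun x => eta x v) z w.

Definition pullback (f : V -> V) (eta : V -> V -> C) (z v : V) : C :=
  eta (f z) (velocity (fun t => f (real_line z v t)) 0).

Definition ddx (f : V -> C) (k : 'I_n) (z : V) : C :=
  d0 f z (delta_mx 0 k).
Definition ddy (f : V -> C) (k : 'I_n) (z : V) : C :=
  d0 f z ('i%C *: delta_mx 0 k).

(* Wirtinger derivatives *)
Definition ddz (f : V -> C) (k : 'I_n) (z : V) : C :=
  (ddx f k z - 'i%C * ddy f k z) / 2.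
Definition ddzbar (f : V -> C) (k : 'I_n) (z : V) : C :=
  (ddx f k z + 'i%C * ddy f k z) / 2.

Definition del (f : V -> C) (z v : V) : C :=
  \sum_(k < n) ddz f k z * v 0 k.
Definition delbar (f : V -> C) (z v : V) : C :=
  \sum_(k < n) ddzbar f k z * (v 0 k)^*%C.

Definition dc (f : V -> C) (z v : V) : C :=
  - 'i%C * (del f z v - delbar f z v).

End ComplexCalculus.

Section Torus.
Variables (R : realType) (n : nat).
Local Notation C := R[i].
Local Notation V := 'rV[R[i]]_n.

(* (C^x)^n and (S^1)^n inside C^n *)
Definition ctorus : set V := [set z | forall k, z 0 k != 0].
Definition real_torus : set V := [set t | forall k, `|t 0 k| = 1].

Definition tmul (t z : V) : V := \row_(k < n) (t 0 k * z 0 k).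

Definition chi (m : 'rV[int]_n) (z : V) : C :=
  \prod_(k < n) (z 0 k) ^ (m 0 k).

(* |chi^m(z)|^2 as a real number; the norm of R[i] takes its values in R[i]. *)
Definition chi2 (m : 'rV[int]_n) (z : V) : R := complex.Re (`|chi m z| ^+ 2).

Definition cexpi (a : R) : C := cos a +i* sin a.

Definition lambda (u : 'rV[int]_n) (t : C) : V := \row_(k < n) t ^ (u 0 k).

Definition X_field (u : 'rV[int]_n) (z : V) : V :=
  velocity (fun a => tmul (lambda u (cexpi a)) z) 0.

Variables (Sigma : set (set 'rV[R]_n)) (psi : 'rV[R]_n -> R).

(* For a complete fan the index set below is finite. *)
Let PZ : set 'rV[int]_n := lattice_points (polytope Sigma psi).

Definition F_fun (z : V) : R := ln (\sum_(m \in PZ) chi2 m z).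

Definition theta (z v : V) : C :=
  2^-1 * dc (fun x => (F_fun x)%:C) z v.

Definition omega : V -> V -> V -> C := d1 theta.

Definition mu (z : V) : 'rV[R]_n :=
  (\sum_(m \in PZ) chi2 m z)^-1 *: \sum_(m \in PZ) (chi2 m z *: intv R m).

End Torus.

(* Main.v *)
Require Import Defs.
From HB Require Import structures.
From mathcomp Require Import all_boot all_order all_algebra.
From mathcomp Require Import all_classical all_reals all_analysis.
From mathcomp Require Import complex ring.
Set Implicit Arguments.
Unset Strict Implicit.
Unset Printing Implicit Defensive.
Import Order.TTheory GRing.Theory Num.Theory.
Import numFieldNormedType.Exports.
Local Open Scope classical_set_scope.
Local Open Scope ring_scope.
Local Open Scope complex_scope.

(* On the complex torus, |chi^m|^2 = exp (sum_k m_k ln |z_k|^2), so the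
   derivative of F along v is 2 sum_k mu_k Re (v_k / z_k), whence
   theta(v) = sum_k mu_k Im (v_k / z_k). Part (2) follows, since neither mu nor
   v_k / z_k changes under the real torus. For part (1), X_k = i u_k z_k, so
   Re (X_k / z_k) = 0 and mu is constant to first order along X; in
   d theta (X, v) the derivatives of v_k / z_k and X_k / z_k (for constant v and
   X) contribute the same term sum_k mu_k u_k Re (v_k / z_k), which cancels and
   leaves - sum_k u_k d mu_k (v). *)

(** * Differentiation rules for real functions of one real variable *)

Section RealDerivatives.
Variable R : realType.
Implicit Types (f g : R -> R) (a : R).

(** This rule and the next ones have functions in pointwise form, to match the goals left by
    [under eq_fun]. *)
Lemma is_derive_add_fun f g a df dg : is_derive a 1 f df -> is_derive a 1 g dg ->
  is_derive a 1 (fun t => f t + g t) (df + dg).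
Proof. exact: is_deriveD. Qed.

Lemma is_derive_opp_fun f a df : is_derive a 1 f df ->
  is_derive a 1 (fun t => - f t) (- df).
Proof. exact: is_deriveN. Qed.

Lemma is_derive_mul_fun f g a df dg : is_derive a 1 f df -> is_derive a 1 g dg ->
  is_derive a 1 (fun t => f t * g t) (df * g a + f a * dg).
Proof.
move=> hf hg; apply: is_derive_eq (is_deriveM hf hg) _.
by rewrite addrC [df * _]mulrC.
Qed.

Lemma is_derive_cst_fun c a : is_derive a 1 (fun=> c : R) 0.
Proof. exact: is_derive_cst. Qed.

Lemma is_derive_inv_fun f a df : f a != 0 -> is_derive a 1 f df ->
  is_derive a 1 (fun t => (f t)^-1) (- (df / f a ^+ 2)).
Proof.
move=> fa0 hf; apply: is_derive_eq (is_deriveV fa0 hf) _.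
by rewrite /GRing.scale /= mulNr mulrC.
Qed.

Lemma is_derive_big_fun (I : Type) (s : seq I) (h : I -> R -> R) (dh : I -> R) a :
  (forall i, is_derive a 1 (h i) (dh i)) ->
  is_derive a 1 (fun t => \sum_(i <- s) h i t) (\sum_(i <- s) dh i).
Proof.
move=> hh; elim: s => [|i s IHs].
  by under eq_fun do rewrite big_nil; rewrite big_nil; exact: is_derive_cst_fun.
under eq_fun do rewrite big_cons; rewrite big_cons.
exact: is_derive_add_fun.
Qed.

Lemma is_derive_comp_fun f g a df dg : is_derive (g a) 1 f df ->
  is_derive a 1 g dg -> is_derive a 1 (fun t => f (g t)) (df * dg).
Proof. exact: is_derive1_comp. Qed.

Lemma derive1_is_derive f a df : is_derive a 1 f df -> derive1 f a = df.
Proof. by move=> hf; rewrite derive1E derive_val. Qed.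

End RealDerivatives.

(** * Complex-valued functions of a real variable *)

Section ComplexDerivatives.
Variable R : realType.
Implicit Types (f g : R -> R[i]) (a : R) (c l : R[i]).

(** Relational companion of [cderive1]: it also records differentiability of both components, which
    the total function [cderive1] cannot express. *)
Definition is_cderive g a l :=
  is_derive a 1 (fun t => complex.Re (g t)) (complex.Re l) /\
  is_derive a 1 (fun t => complex.Im (g t)) (complex.Im l).

Lemma is_cderive_val g a l : is_cderive g a l -> cderive1 g a = l.
Proof.
case: l => x y [/= h1 h2]; rewrite /cderive1.
by rewrite (derive1_is_derive h1) (derive1_is_derive h2).
Qed.

Lemma is_cderive_eq g a l l' : is_cderive g a l -> l = l' -> is_cderive g a l'.
Proof. by move=> ? <-. Qed.

Lemma near_eq_is_cderive f g a l : (\near a, f a = g a) ->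
  is_cderive f a l -> is_cderive g a l.
Proof.
by move=> fg [h1 h2]; split; [move: h1|move: h2];
  apply: near_eq_is_derive; apply: filterS fg => t ->.
Qed.

Lemma is_cderive_cst c a : is_cderive (fun=> c) a 0.
Proof. by split; exact: is_derive_cst_fun. Qed.

Lemma is_cderive_real (f : R -> R) a df : is_derive a 1 f df ->
  is_cderive (fun t => (f t)%:C) a df%:C.
Proof. by move=> hf; split=> //=; exact: is_derive_cst_fun. Qed.

Lemma complex_ReD (x y : R[i]) : complex.Re (x + y) = complex.Re x + complex.Re y.
Proof. exact: raddfD. Qed.

Lemma complex_ImD (x y : R[i]) : complex.Im (x + y) = complex.Im x + complex.Im y.
Proof. exact: raddfD. Qed.

Lemma complex_ReN (x : R[i]) : complex.Re (- x) = - complex.Re x.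
Proof. by case: x. Qed.

Lemma complex_ImN (x : R[i]) : complex.Im (- x) = - complex.Im x.
Proof. by case: x. Qed.

Lemma complex_ReM (x y : R[i]) : complex.Re (x * y) =
  complex.Re x * complex.Re y - complex.Im x * complex.Im y.
Proof. by case: x; case: y. Qed.

Lemma complex_ImM (x y : R[i]) : complex.Im (x * y) =
  complex.Re x * complex.Im y + complex.Im x * complex.Re y.
Proof. by case: x; case: y. Qed.

Lemma is_cderiveD f g a df dg : is_cderive f a df -> is_cderive g a dg ->
  is_cderive (fun t => f t + g t) a (df + dg).
Proof.
move=> [h1 h2] [h3 h4]; split.
  by rewrite complex_ReD; under eq_fun do rewrite complex_ReD; exact: is_derive_add_fun.
by rewrite complex_ImD; under eq_fun do rewrite complex_ImD; exact: is_derive_add_fun.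
Qed.

Lemma is_cderiveM f g a df dg : is_cderive f a df -> is_cderive g a dg ->
  is_cderive (fun t => f t * g t) a (df * g a + f a * dg).
Proof.
move=> [h1 h2] [h3 h4]; split.
  under eq_fun do rewrite complex_ReM.
  apply: is_derive_eq (is_derive_add_fun (is_derive_mul_fun h1 h3)
    (is_derive_opp_fun (is_derive_mul_fun h2 h4))) _.
  by rewrite complex_ReD !complex_ReM; ring.
under eq_fun do rewrite complex_ImM.
apply: is_derive_eq (is_derive_add_fun (is_derive_mul_fun h1 h4)
  (is_derive_mul_fun h2 h3)) _.
by rewrite complex_ImD !complex_ImM; ring.
Qed.

(** The squared modulus with values in [R]: a polynomial in both components, hence differentiable
    even at 0. *)
Definition normsq c : R := complex.Re c ^+ 2 + complex.Im c ^+ 2.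

Lemma normsqE c : (normsq c)%:C = `|c| ^+ 2.
Proof. exact: add_Re2_Im2. Qed.

Lemma normsq_gt0 c : (0 < normsq c) = (c != 0).
Proof. by rewrite -ltcR normsqE -normrX normr_gt0 expf_eq0. Qed.

Lemma normsqX c k : normsq (c ^+ k) = normsq c ^+ k.
Proof.
by apply: complexI; rewrite rmorphXn /= !normsqE normrX -!exprM mulnC.
Qed.

Lemma complex_ReV c : complex.Re c^-1 = complex.Re c / normsq c.
Proof. by case: c. Qed.

Lemma complex_ImV c : complex.Im c^-1 = - (complex.Im c / normsq c).
Proof. by case: c. Qed.

Lemma normr_exprz (x : R[i]) (p : int) : `|x ^ p| = `|x| ^ p.
Proof. by case: p => p; rewrite ?NegzE -?exprnN ?normfV normrX. Qed.

Lemma is_derive_normsq g a l : is_cderive g a l ->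
  is_derive a 1 (fun t => normsq (g t))
    (2 * (complex.Re (g a) * complex.Re l + complex.Im (g a) * complex.Im l)).
Proof.
move=> [h1 h2]; apply: is_derive_eq (is_derive_add_fun
  (is_derive_mul_fun h1 h1) (is_derive_mul_fun h2 h2)) _.
by ring.
Qed.

(** Each component of 1/c is, up to sign, that of c divided by |c|^2, so the real quotient rule
    applies and a field identity remains. *)
Lemma is_cderiveV g a l : g a != 0 -> is_cderive g a l ->
  is_cderive (fun t => (g t)^-1) a (- (l / g a ^+ 2)).
Proof.
move=> ga0 hg; have N0 : normsq (g a) != 0 by rewrite gt_eqF // normsq_gt0.
have hN := is_derive_inv_fun (f := fun t => normsq (g t)) N0 (is_derive_normsq hg).
case: hg => h1 h2; split.
  under eq_fun do rewrite complex_ReV.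
  apply: is_derive_eq (is_derive_mul_fun h1 hN) _.
  rewrite complex_ReN complex_ReM complex_ReV complex_ImV normsqX.
  rewrite (expr2 (g a)) complex_ReM complex_ImM; move: N0; rewrite /normsq.
  by case: (g a) => x y /=; case: (l) => p q /= N0; field.
under eq_fun do rewrite complex_ImV.
apply: is_derive_eq (is_derive_opp_fun (is_derive_mul_fun h2 hN)) _.
rewrite complex_ImN complex_ImM complex_ReV complex_ImV normsqX.
rewrite (expr2 (g a)) complex_ReM complex_ImM; move: N0; rewrite /normsq.
by case: (g a) => x y /=; case: (l) => p q /= N0; field.
Qed.

(** At a point where g equals 1 the factor g^(p-1) is 1. This covers [cexpi] at 0, which is what
    [X_field] requires. *)
Lemma is_cderive_exprz (g : R -> R[i]) a l (p : int) : g a = 1 ->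
  is_cderive g a l -> is_cderive (fun t => g t ^ p) a (p%:~R * l).
Proof.
move=> g1 hg.
have hX (q : nat) : is_cderive (fun t => g t ^+ q) a (q%:R * l).
  elim: q => [|q IHq].
    by under eq_fun do rewrite expr0; rewrite mul0r; exact: is_cderive_cst.
  under eq_fun do rewrite exprS.
  apply: is_cderive_eq (is_cderiveM hg IHq) _.
  by rewrite g1 expr1n mulr1 mul1r -[in RHS]natr1 mulrDl mul1r addrC.
case: p => q; first exact: hX.
apply: is_cderive_eq (is_cderiveV (g := fun t => g t ^+ q.+1) _ (hX q.+1)) _.
  by rewrite g1 expr1n oner_neq0.
by rewrite g1 !expr1n divr1 NegzE mulrNz mulNr.
Qed.

Lemma is_cderive_cexpi : is_cderive (@cexpi R) 0 'i.
Proof.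
split=> /=.
  by apply: is_derive_eq (is_derive_cos _) _; rewrite sin0 oppr0.
by apply: is_derive_eq (is_derive_sin _) _; rewrite cos0.
Qed.

End ComplexDerivatives.

(** * Characters restricted to real lines in the complex torus *)

Section Lines.
Variables (R : realType) (n : nat).
Local Notation V := 'rV[R[i]]_n.
Implicit Types (z v w : V) (m : 'rV[int]_n).

Lemma real_line0 z v : real_line z v 0 = z.
Proof. by rewrite /real_line scale0r addr0. Qed.

Lemma is_cderive_line z v k :
  is_cderive (fun t => real_line z v t 0 k) 0 (v 0 k).
Proof.
under eq_fun do rewrite !mxE.
apply: is_cderive_eq (is_cderiveD (is_cderive_cst _ _)
  (is_cderiveM (is_cderive_real (is_derive_id _ _)) (is_cderive_cst _ _))) _.
by rewrite mulr0 addr0 add0r mul1r.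
Qed.

(** Each of the finitely many coordinates stays nonzero because its [normsq] is continuous in t.
    Formulas valid only on the torus can thus be differentiated. *)
Lemma near_ctorus z v : ctorus z -> \forall t \near 0, ctorus (real_line z v t).
Proof.
move=> hz.
suff h k : \forall t \near (0 : R), real_line z v t 0 k != 0.
  by apply: (filter_forall _ h).
have hN := is_derive_normsq (is_cderive_line z v k).
have /derivable1_diffP/differentiable_continuous hc := @ex_derive _ _ _ _ _ _ _ hN.
have N0 : 0 < normsq (real_line z v 0 0 k) by rewrite normsq_gt0 real_line0.
apply: filterS (cvgr_gt _ hc _ N0) => t /=.
by rewrite normsq_gt0.
Qed.

Lemma is_derive_ln_normsq z v k : z 0 k != 0 ->
  is_derive (0 : R) 1 (fun t => ln (normsq (real_line z v t 0 k)))
    (2 * complex.Re (v 0 k / z 0 k)).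
Proof.
move=> zk0; have N0 : 0 < normsq (z 0 k) by rewrite normsq_gt0.
have hN := is_derive_normsq (is_cderive_line z v k).
have hl : is_derive (normsq (real_line z v 0 0 k)) 1 (@ln R) (normsq (z 0 k))^-1.
  by rewrite real_line0; exact: is_derive1_ln.
apply: is_derive_eq
  (is_derive_comp_fun (g := fun t => normsq (real_line z v t 0 k)) hl hN) _.
by rewrite real_line0 complex_ReM complex_ReV complex_ImV; ring.
Qed.

Lemma chi2_tmul m w z : real_torus w -> chi2 m (tmul w z) = chi2 m z.
Proof.
move=> hw; rewrite /chi2 /chi !normr_prod.
congr (complex.Re (_ ^+ _)); apply: eq_bigr => k _.
by rewrite mxE !normr_exprz normrM hw mul1r.
Qed.

Lemma chi2E m z : ctorus z ->
  chi2 m z = expR (\sum_(k < n) (m 0 k)%:~R * ln (normsq (z 0 k))).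
Proof.
move=> hz; rewrite expR_sum /chi2 /chi normr_prod -prodrXl.
under eq_bigr => k _.
  rewrite normr_exprz exprnP exprzAC -exprnP -normsqE.
  have N0 : 0 < normsq (z 0 k) by rewrite normsq_gt0; exact: hz.
  have -> : (normsq (z 0 k))%:C ^ (m 0 k) =
    (expR ((m 0 k)%:~R * ln (normsq (z 0 k))))%:C.
    (* The real power [powR] links the exponential of a multiple of [ln] to the integer power. *)
    rewrite -[in RHS]ln_powR powR_intmul ?ltW // lnK ?posrE ?exprz_gt0 //.
    by case: (m 0 k) => p; rewrite ?NegzE -?exprnN ?fmorphV rmorphXn.
  over.
by rewrite -rmorph_prod.
Qed.

Lemma chi2_gt0 m z : ctorus z -> 0 < chi2 m z.
Proof. by move=> /chi2E ->; exact: expR_gt0. Qed.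

Lemma is_derive_chi2 m z v : ctorus z ->
  is_derive (0 : R) 1 (fun t => chi2 m (real_line z v t))
    (chi2 m z * \sum_(k < n) (m 0 k)%:~R * (2 * complex.Re (v 0 k / z 0 k))).
Proof.
move=> hz; apply: near_eq_is_derive.
  by apply: filterS (near_ctorus v hz) => t /chi2E ->; reflexivity.
have hs : is_derive (0 : R) 1
    (fun t => \sum_(k < n) (m 0 k)%:~R * ln (normsq (real_line z v t 0 k)))
    (\sum_(k < n) (m 0 k)%:~R * (2 * complex.Re (v 0 k / z 0 k))).
  apply: is_derive_big_fun => k.
  apply: is_derive_eq (is_derive_mul_fun (is_derive_cst_fun _ _)
    (is_derive_ln_normsq v (hz k))) _.
  by rewrite mul0r add0r.
apply: is_derive_eq (is_derive_comp_fun (is_derive_expR _) hs) _.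
by rewrite real_line0 -chi2E.
Qed.

Lemma is_derive_ctorus_eq (f g : V -> R) z v l : ctorus z ->
  (forall x, ctorus x -> f x = g x) ->
  is_derive (0 : R) 1 (fun t => g (real_line z v t)) l ->
  is_derive (0 : R) 1 (fun t => f (real_line z v t)) l.
Proof.
move=> hz fg; apply: near_eq_is_derive.
by apply: filterS (near_ctorus v hz) => t /fg.
Qed.

End Lines.

(** * The potential, the moment map and the invariant 1-form *)

Section TorusForms.
Variables (R : realType) (n : nat).
Variables (Sigma : set (set 'rV[R]_n)) (psi : 'rV[R]_n -> R).
Local Notation V := 'rV[R[i]]_n.
Local Notation PZ := (lattice_points (polytope Sigma psi)).
Local Notation mass z := (\sum_(m \in PZ) chi2 m z).
Implicit Types (z v w : V) (u : 'rV[int]_n).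

(* If the polytope has infinitely many lattice points, the finitely supported
   sums of Defs are 0 by convention, which is the first alternative. *)
Lemma mass_cases :
  (forall z, ctorus z -> mass z = 0) \/
  exists s : seq 'rV[int]_n,
    [/\ forall z, ctorus z -> 0 < mass z,
        forall z, mass z = \sum_(m <- s) chi2 m z
      & forall z k, mu Sigma psi z 0 k =
          (\sum_(m <- s) chi2 m z)^-1 * \sum_(m <- s) chi2 m z * (m 0 k)%:~R].
Proof.
have [finP|infP] := pselect (finite_set PZ); last first.
  (* On the torus no term vanishes, so the support of the sum is the whole infinite index set. *)
  left=> z hz; apply: fsbig_dflt; apply: contra_not infP.
  apply: sub_finite_set => m Pm; split=> //=.
  by move/eqP; rewrite gt_eqF // chi2_gt0.
set s := finmap.enum_fset (fset_set PZ).
have massE z : mass z = \sum_(m <- s) chi2 m z by exact: fsbig_finite.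
(* An empty index set also gives mass 0 and joins the degenerate alternative. *)
have [s0|s0] := eqVneq s [::].
  by left=> z _; rewrite massE s0 big_nil.
right; exists s; split=> // [z hz|z k].
  rewrite massE; case: (s) s0 => // m s' _; rewrite big_cons.
  by rewrite ltr_pwDl ?chi2_gt0 // sumr_ge0 // => i _; rewrite ltW ?chi2_gt0.
rewrite /mu massE (fsbig_finite _ _ finP) -/s mxE summxE.
by congr (_ * _); apply: eq_bigr => m _; rewrite !mxE.
Qed.

Lemma mu_tmul w z : real_torus w -> mu Sigma psi (tmul w z) = mu Sigma psi z.
Proof.
move=> hw; rewrite /mu.
congr (_^-1 *: _); apply: eq_fsbigr => m _; by rewrite chi2_tmul.
Qed.

Lemma is_derive_F z v : ctorus z ->
  is_derive (0 : R) 1 (fun t => F_fun Sigma psi (real_line z v t))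
    (2 * \sum_(k < n) mu Sigma psi z 0 k * complex.Re (v 0 k / z 0 k)).
Proof.
move=> hz; have [S0|[s [Sgt0 SE muE]]] := mass_cases.
  (* With zero mass, the conventions 0^-1 = 0 and ln 0 = 0 make both [mu] and [F_fun] vanish on the
     torus. *)
  rewrite big1 ?mulr0 => [|k _]; last by rewrite /mu S0 // invr0 scale0r mxE mul0r.
  apply: (is_derive_ctorus_eq (g := fun=> 0) hz _ (is_derive_cst_fun (0 : R) _)) => x hx.
  by rewrite /F_fun S0 // ln0.
have hS := is_derive_big_fun s (fun m => is_derive_chi2 m v hz).
have hl : is_derive (\sum_(m <- s) chi2 m (real_line z v 0)) 1 (@ln R)
    (\sum_(m <- s) chi2 m z)^-1.
  by rewrite real_line0; apply: is_derive1_ln; rewrite -SE Sgt0.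
rewrite /F_fun; under eq_fun do rewrite SE.
apply: is_derive_eq (is_derive_comp_fun
  (g := fun t => \sum_(m <- s) chi2 m (real_line z v t)) hl hS) _.
rewrite !mulr_sumr; under eq_bigr do rewrite !mulr_sumr.
(* With the coordinate sum outside, the inner sum over m is the weighted mean defining [mu]. *)
rewrite exchange_big; apply: eq_bigr => k _ /=.
rewrite muE mulr_sumr mulr_suml mulr_sumr; apply: eq_bigr => m _; ring.
Qed.

(** The value D stays implicit: in the moment map identity it occurs on both sides for a general v,
    and only its vanishing along [X_field] has to be known. *)
Lemma is_derive_mu z v k : ctorus z ->
  exists2 D, is_derive (0 : R) 1 (fun t => mu Sigma psi (real_line z v t) 0 k) D
    & (forall j, complex.Re (v 0 j / z 0 j) = 0) -> D = 0.
Proof.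
move=> hz; have [S0|[s [Sgt0 SE muE]]] := mass_cases.
  exists 0 => //.
  apply: (is_derive_ctorus_eq (f := fun x => mu Sigma psi x 0 k) (g := fun=> 0) hz _
    (is_derive_cst_fun (0 : R) _)) => x hx.
  by rewrite /mu S0 // invr0 scale0r mxE.
have hS := is_derive_big_fun s (fun m => is_derive_chi2 m v hz).
have hT := is_derive_big_fun s (fun m => is_derive_mul_fun
  (is_derive_chi2 m v hz) (is_derive_cst_fun (m 0 k)%:~R 0)).
have S0 : \sum_(m <- s) chi2 m (real_line z v 0) != 0.
  by rewrite -SE real_line0 gt_eqF // Sgt0.
have hI := is_derive_inv_fun
  (f := fun t => \sum_(m <- s) chi2 m (real_line z v t)) S0 hS.
have hM := is_derive_mul_fun hI hT.
eexists; first by under eq_fun do rewrite muE; exact: hM.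
(* Every [chi2 m] is stationary along v, hence so are numerator and denominator of [mu]. *)
move=> v0; have d0 m : \sum_(j < n) (m 0 j)%:~R * (2 * complex.Re (v 0 j / z 0 j)) = 0.
  by rewrite big1 // => j _; rewrite v0 !mulr0.
under eq_bigr do rewrite d0 mulr0.
under [in X in _ + _ * X]eq_bigr do rewrite d0 !mulr0 mul0r add0r.
by rewrite !big1_eq mul0r oppr0 mul0r mulr0 addr0.
Qed.

Lemma d0_F z v : ctorus z ->
  d0 (fun x => (F_fun Sigma psi x)%:C) z v =
  (2 * \sum_(k < n) mu Sigma psi z 0 k * complex.Re (v 0 k / z 0 k))%:C.
Proof. by move=> hz; apply/is_cderive_val/is_cderive_real/is_derive_F. Qed.

(** Here [del] of F is S = sum_k mu_k v_k / z_k and [delbar] is its conjugate. Their difference is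
    2i Im S, and the factors -i and 1/2 leave Im S. *)
Lemma theta_ctorus z v : ctorus z ->
  theta Sigma psi z v =
  (\sum_(k < n) mu Sigma psi z 0 k * complex.Im (v 0 k / z 0 k))%:C.
Proof.
move=> hz; pose F x := (F_fun Sigma psi x)%:C.
(* The scalar c is 1 for [ddx] and i for [ddy]. *)
have dF k (c : R[i]) : d0 F z (c *: delta_mx 0 k) =
    (2 * (mu Sigma psi z 0 k * complex.Re (c / z 0 k)))%:C.
  rewrite d0_F // (bigD1 k) //= big1 => [|j jk].
    by rewrite !mxE !eqxx mulr1 addr0.
  by rewrite !mxE eqxx (negbTE jk) mulr0 mul0r mulr0.
have dx k : ddx F k z = (2 * (mu Sigma psi z 0 k * complex.Re (z 0 k)^-1))%:C.
  by rewrite /ddx -[delta_mx _ _]scale1r dF mul1r.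
have dy k : ddy F k z = - (2 * (mu Sigma psi z 0 k * complex.Im (z 0 k)^-1))%:C.
  by rewrite /ddy dF complex_ReM /= mul0r mul1r sub0r !mulrN rmorphN.
rewrite /theta /dc /del /delbar -/F -sumrB rmorph_sum !mulr_sumr.
apply: eq_bigr => k _; rewrite /ddz /ddzbar dx dy complex_ImM.
case: (v 0 k) => p q; case: (z 0 k)^-1 => x y.
set c := mu _ _ _ _ _; move: c => c.
have -> : (2 : R[i]) = 2%:C by rewrite rmorph_nat.
rewrite -!fmorphV; simpc.
by apply/eqP; rewrite eq_complex /=; apply/andP; split; apply/eqP; field.
Qed.

(** Multiplication by w is linear, so it is its own differential. *)
Lemma pullback_tmul w eta z v :
  pullback (tmul w) eta z v = eta (tmul w z) (tmul w v).
Proof.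
rewrite /pullback; congr eta; apply/rowP => k; rewrite !mxE.
apply: is_cderive_val; under eq_fun do rewrite mxE.
apply: is_cderive_eq (is_cderiveM (is_cderive_cst _ _) (is_cderive_line z v k)) _.
by rewrite mul0r add0r.
Qed.

Lemma theta_tmul w z v : real_torus w -> ctorus z ->
  theta Sigma psi (tmul w z) (tmul w v) = theta Sigma psi z v.
Proof.
move=> hw hz.
have w0 k : w 0 k != 0 by rewrite -normr_eq0 hw oner_neq0.
rewrite !theta_ctorus // => [|k]; last by rewrite mxE mulf_neq0.
rewrite mu_tmul //; congr (_%:C); apply: eq_bigr => k _.
by rewrite !mxE invfM mulrACA divff // mul1r.
Qed.

(** * The generating vector fields and the moment map identity *)

Lemma X_fieldE u z k : X_field u z 0 k = (u 0 k)%:~R * 'i%C * z 0 k.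
Proof.
rewrite mxE; apply: is_cderive_val; under eq_fun do rewrite !mxE.
have e0 : @cexpi R 0 = 1 by rewrite /cexpi cos0 sin0.
apply: is_cderive_eq (is_cderiveM
  (is_cderive_exprz (u 0 k) e0 (is_cderive_cexpi R)) (is_cderive_cst _ _)) _.
by rewrite mulr0 addr0.
Qed.

Lemma X_field_div u z k : z 0 k != 0 ->
  X_field u z 0 k / z 0 k = 0 +i* (u 0 k)%:~R.
Proof.
move=> zk0; rewrite X_fieldE mulfK //.
have -> : ((u 0 k)%:~R : R[i]) = ((u 0 k)%:~R : R)%:C by rewrite rmorph_int.
by simpc.
Qed.

(** The product rule with y held constant: the first term differentiates [mu], the second 1/z_k. The
    latter is symmetric in y and v, hence cancels in [d1]. *)
Lemma d0_theta z v y (D : 'I_n -> R) : ctorus z ->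
  (forall k, is_derive (0 : R) 1 (fun t => mu Sigma psi (real_line z v t) 0 k) (D k)) ->
  d0 (fun x => theta Sigma psi x y) z v =
  (\sum_(k < n) (D k * complex.Im (y 0 k / z 0 k) -
     mu Sigma psi z 0 k * complex.Im (y 0 k / z 0 k * (v 0 k / z 0 k))))%:C.
Proof.
move=> hz hD; apply: is_cderive_val.
apply: near_eq_is_cderive.
  by apply: filterS (near_ctorus v hz) => t /theta_ctorus ->; reflexivity.
apply/is_cderive_real/is_derive_big_fun => k.
have zk0 : real_line z v 0 0 k != 0 by rewrite real_line0; exact: hz.
have [_ hI] := is_cderiveM (is_cderive_cst (y 0 k) 0)
  (is_cderiveV (g := fun t => real_line z v t 0 k) zk0 (is_cderive_line z v k)).
apply: is_derive_eq (is_derive_mul_fun (hD k) hI) _.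
rewrite real_line0 mul0r add0r mulrN complex_ImN mulrN; congr (_ - _ * complex.Im _).
by rewrite expr2 invfM mulrACA !mulrA.
Qed.

Lemma omega_X_field u z v : ctorus z ->
  omega Sigma psi z (X_field u z) v =
  - d0 (fun x => (dotr (mu Sigma psi x) (intv R u))%:C) z v.
Proof.
move=> hz.
have hex k : exists d : R,
    is_derive (0 : R) 1 (fun t => mu Sigma psi (real_line z v t) 0 k) d.
  by have [d hd _] := is_derive_mu v k hz; exists d.
have [D hD] := boolp.choice hex.
(* Infinitesimal torus invariance of [mu]: the ratios X_k / z_k are purely imaginary. *)
have hX k : is_derive (0 : R) 1
    (fun t => mu Sigma psi (real_line z (X_field u z) t) 0 k) 0.
  have [d hd hd0] := is_derive_mu (X_field u z) k hz.
  by apply: is_derive_eq hd (hd0 _) => j; rewrite X_field_div.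
have -> : d0 (fun x => (dotr (mu Sigma psi x) (intv R u))%:C) z v =
    (\sum_(k < n) D k * (u 0 k)%:~R)%:C.
  apply/is_cderive_val/is_cderive_real/is_derive_big_fun => k.
  apply: is_derive_eq (is_derive_mul_fun (hD k) (is_derive_cst_fun _ _)) _.
  by rewrite mulr0 addr0 mxE.
rewrite /omega /d1 (d0_theta _ hz hX) (d0_theta _ hz hD) -rmorphB -rmorphN.
rewrite -sumrB -sumrN; congr (_%:C); apply: eq_bigr => k _.
(* The symmetric terms cancel and Im (X_k / z_k) = u_k leaves -D_k u_k. *)
rewrite X_field_div // !complex_ImM /=; ring.
Qed.

End TorusForms.

Theorem proposition4p10 (R : realType) (n : nat) (hn : (0 < n)%N)
    (Sigma : set (set 'rV[R]_n)) (hSigma : complete_fan Sigma)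
    (phi : 'rV[R]_n -> R) (hrat : rational_PL Sigma phi)
    (hconc : strictly_concave Sigma phi)
    (r : nat) (hr : (0 < r)%N) (rphi := fun x => r%:R * phi x)
    (hint : integral_PL Sigma rphi) :
  (forall rho, rays Sigma rho ->
     forall z, ctorus z -> forall v : 'rV[R[i]]_n,
       omega Sigma rphi z (X_field (prim_gen rho) z) v =
       - d0 (fun x => (dotr (mu Sigma rphi x) (intv R (prim_gen rho)))%:C) z v)
  /\
  (forall t, real_torus t ->
     forall z, ctorus z -> forall v : 'rV[R[i]]_n,
       pullback (tmul t) (theta Sigma rphi) z v = theta Sigma rphi z v).
Proof.
split=> [rho _ z hz v|t ht z hz v]; first exact: omega_X_field.
by rewrite pullback_tmul theta_tmul.
Qed.
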